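(* Let $\mathrm{G}$ be a subgroup of the symmetric group of a countably infinite set $U$. If there are two age indivisible types $\underline{T}$ and $\underline{S}$ of $\mathrm{G}$, both having infinite typesets, such that $\rho(\underline{T})\setminus\rho(\underline{S})\neq\emptyset$ and $\rho(\underline{S})\setminus\rho(\underline{T})\neq\emptyset$, then $\mathrm{G}$ is divisible.
   Context: For $S\subseteq U$, the $\mathrm{G}$-age $\rho(S)$ is the set of finite $A\subseteq U$ for which some $g\in\mathrm{G}$ satisfies $g[A]\subseteq S$. $\mathrm{G}_F$ denotes the pointwise stabilizer of $F$ in $\mathrm{G}$. A type of $\mathrm{G}$ is a pair $\langle F\mid x\rangle$ with $F\subseteq U$ finite and $x\in U\setminus F$; its typeset is $\sigma(\langle F\mid x\rangle)=\{g(x):g\in \mathrm{G}_F\}$ and its rank is $\rho(\underline{T})=\rho(\sigma(\underline{T}))$. A set $S\subseteq U$ is age indivisible if for every partition $(S_0,S_1)$ of $S$ we have $\rho(S_0)=\rho(S)$ or $\rho(S_1)=\rho(S)$; a type is age indivisible if its typeset is. An embedding for $\mathrm{G}$ is an injection $f:U\to U$ such that for every finite $A\subseteq U$ some $g\in\mathrm{G}$ agrees with $f$ on $A$. $\mathrm{G}$ is indivisible if for every partition $(S_0,S_1)$ of $U$ there are $i\in 2$ and an embedding $f$ for $\mathrm{G}$ with $f[U]\subseteq S_i$; otherwise $\mathrm{G}$ is divisible. *)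

(* Defs.v *)
From mathcomp Require Import ssreflect ssrfun ssrbool eqtype ssrnat.
From mathcomp Require Import boolp classical_sets functions cardinality.

Set Implicit Arguments.
Unset Strict Implicit.
Unset Printing Implicit Defensive.

Local Open Scope classical_set_scope.

(* A subgroup of Sym(U), as a set of self-maps of U: [h] below is forced to be
   the inverse permutation of [g]. *)
Definition permutation_group (U : Type) (G : set (U -> U)) : Prop :=
  [/\ forall g, G g -> bijective g,
      G id,
      forall g h, G g -> G h -> G (g \o h)
    & forall g h, G g -> cancel g h -> cancel h g -> G h].

Definition partition2 (U : Type) (S S0 S1 : set U) : Prop :=
  S0 `|` S1 = S /\ S0 `&` S1 = set0.

Definition age (U : Type) (G : set (U -> U)) (S : set U) : set (set U) :=
  [set A | finite_set A /\ exists2 g, G g & g @` A `<=` S].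

Definition stabilizer (U : Type) (G : set (U -> U)) (F : set U) :
    set (U -> U) :=
  [set g | G g /\ forall y, F y -> g y = y].

(* The pairs < F | x >; which pairs are types does not depend on the group. *)
Record gtype (U : Type) := GType {
  gbase : set U;
  gpoint : U;
  gbase_finite : finite_set gbase;
  gpoint_notin : ~ gbase gpoint
}.

Definition typeset (U : Type) (G : set (U -> U)) (T : gtype U) : set U :=
  [set g (gpoint T) | g in stabilizer G (gbase T)].

Definition rank (U : Type) (G : set (U -> U)) (T : gtype U) : set (set U) :=
  age G (typeset G T).

Definition age_indivisible (U : Type) (G : set (U -> U)) (S : set U) : Prop :=
  forall S0 S1 : set U, partition2 S S0 S1 ->
    age G S0 = age G S \/ age G S1 = age G S.

Definition age_indivisible_type (U : Type) (G : set (U -> U)) (T : gtype U) :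
    Prop :=
  age_indivisible G (typeset G T).

Definition embedding (U : Type) (G : set (U -> U)) (f : U -> U) : Prop :=
  injective f /\
  forall A : set U, finite_set A ->
    exists2 g, G g & forall a, A a -> g a = f a.

Definition indivisible (U : Type) (G : set (U -> U)) : Prop :=
  forall S0 S1 : set U, partition2 [set: U] S0 S1 ->
    exists i : bool, exists2 f, embedding G f &
      range f `<=` (if i then S1 else S0).

Definition divisible (U : Type) (G : set (U -> U)) : Prop :=
  ~ indivisible G.

(* Main.v *)
(** A partition defeats every embedding as soon as no translate of the typeset
    of [T] meets [S0] in a set of full age [rank T], and no translate of the
    typeset of [S] meets [S1] in a set of full age [rank S].  There are only
    countably many translates [T_0, T_1, ...] and [S_0, S_1, ...], since a
    translate is determined by the image of the finite base.  Put a point into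
    [S1] when it is met by the [T_n] no later than by the [S_n]; then [T_n]
    meets [S0] inside [S_0, ..., S_(n-1)] and [S_m] meets [S1] inside
    [T_0, ..., T_m].  By age indivisibility, a finite union of full age has a
    member of full age, so an embedding into [S0] or [S1] would force [rank T]
    and [rank S] to be comparable. *)
Require Import Defs.
From mathcomp Require Import ssreflect ssrfun ssrbool eqtype ssrnat.
From mathcomp Require Import seq choice bigop.
From mathcomp Require Import boolp classical_sets functions cardinality filter.

Local Open Scope classical_set_scope.
Local Open Scope card_scope.

Lemma ageS (U : Type) (G : set (U -> U)) (X Y : set U) :
  X `<=` Y -> age G X `<=` age G Y.
Proof.
move=> XY A [finA [g Gg gA]]; split=> //; exists g => //.
exact: subset_trans XY.
Qed.

Lemma age_preimage (U : Type) (G : set (U -> U)) (X A : set U) (g : U -> U) :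
  permutation_group G -> G g -> age G X (g @` A) -> finite_set A -> age G X A.
Proof.
move=> [_ _ Gcomp _] Gg [_ [h Gh hX]] finA; split=> //.
exists (h \o g); first exact: Gcomp.
by move=> _ [a Aa <-]; apply: hX; exists (g a) => //; exists a.
Qed.

(** The cones of finite supersets form a filter base: each contains its vertex, and the cone over a
    union lies in both cones. *)
Lemma finite_superset_ultrafilter (U : Type) :
  exists F : set_system (set U), UltraFilter F /\
    forall D, finite_set D -> F [set C | finite_set C /\ D `<=` C].
Proof.
pose B (D : set U) := [set C | finite_set C /\ D `<=` C].
have FF : Filter (filter_from finite_set B).
  apply: filter_from_filter; first by exists set0; apply: finite_set0.
  move=> D E finD finE; exists (D `|` E); first by rewrite finite_setU.
  by move=> C [finC DEC]; split; split=> // x ?; apply: DEC; [left|right].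
have PF : ProperFilter (filter_from finite_set B).
  by apply: filter_from_proper => D finD; exists D; split.
have [F [UF sub]] := ultraFilterLemma PF.
by exists F; split=> // D finD; apply: sub; exists D.
Qed.

(* Copy each finite [C] included in [X] into [P `|` Q] by some [g C].  An
   ultrafilter on the finite sets turns the colorings [P \o g C] of these [C]
   into one coloring of [X], of which a class of full age witnesses that [P]
   or [Q] has full age. *)
Lemma age_indivisible_setU (U : Type) (G : set (U -> U)) (X P Q : set U) :
  permutation_group G -> age_indivisible G X ->
  age G X `<=` age G (P `|` Q) ->
  age G X `<=` age G P \/ age G X `<=` age G Q.
Proof.
move=> GG indX sXPQ; have [_ G1 Gcomp _] := GG.
have [F [UF Fsup]] := finite_superset_ultrafilter U.
have FF : Filter F by apply: filter_filter.
have [g gP] : {g : set U -> U -> U & forall C,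
    finite_set C -> C `<=` X -> G (g C) /\ g C @` C `<=` P `|` Q}.
  apply: (@choice _ _ (fun C h => finite_set C -> C `<=` X ->
    G h /\ h @` C `<=` P `|` Q)) => C.
  have [[finC CX]|nC] := pselect (finite_set C /\ C `<=` X).
    have [|_ [h Gh hC]] := sXPQ C; last by exists h.
    by split=> //; exists id; rewrite ?image_id.
  by exists id => ? ?; case: nC.
have near_color (R : set U) A : finite_set A -> A `<=` X ->
    (forall a, A a -> F [set C | R (g (C `&` X) a)]) -> age G R A.
  move=> finA AX FA.
  (* One condition per point of the finite [A]: all hold together on a member of [F], and a finite
     [C] in it that includes [A] yields one map carrying [A] into [R]. *)
  have FAA : F [set C | forall a, A a -> R (g (C `&` X) a)].
    have /(@finite_fsetP {classic U})[s sE] := finA.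
    have := @filter_bigI _ {classic U} s
      (fun a => [set C | R (g (C `&` X) a)]) F FF.
    rewrite -sE => H; apply: filterS (H _) => [C CA a /CA //|a as_].
    by apply: FA; rewrite sE.
  have [C [RC [finC AC]]] := filter_ex (filterI FAA (Fsup _ finA)).
  have [||Gg _] := gP (C `&` X); last 1 first.
  - by split=> //; exists (g (C `&` X)) => // _ [a Aa <-]; apply: RC.
  - exact: sub_finite_set finC.
  - exact: subIsetr.
have full (R X' : set U) : X' `<=` X -> age G X' = age G X ->
    (forall x, X' x -> F [set C | R (g (C `&` X) x)]) -> age G X `<=` age G R.
  move=> X'X <- X'R A [finA [h Gh hA]].
  (* [A] need not lie in [X'], but its copy by [h] does. *)
  apply: (@age_preimage _ _ _ _ h) => //; apply: near_color.
  - exact: finite_image.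
  - exact: subset_trans X'X.
  - by move=> a /hA /X'R.
pose X0 := [set x | X x /\ F [set C | P (g (C `&` X) x)]].
have [|eX|eX] := indX X0 (X `\` X0).
- by split; [rewrite setDUK// => x []|rewrite setDIK].
- by left; apply: full eX _ => x [].
- right; apply: full eX _ => [x []//|x [Xx nX0]].
  have [Fx|Fx] := in_ultra_setVsetC [set C | P (g (C `&` X) x)] UF.
    by case: nX0.
  (* Once [C] contains [x], the image of [x] lies in [P] or [Q], so missing [P] means hitting
     [Q]. *)
  apply: filterS (filterI Fx (Fsup _ (finite_set1 x))) => C [/= nP [finC xC]].
  have [||_ gPQ] := gP (C `&` X).
  + exact: sub_finite_set finC.
  + exact: subIsetr.
  have [//|//] : (P `|` Q) (g (C `&` X) x).
  by apply: gPQ; exists x => //; split=> //; apply: xC.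
Qed.

Lemma age_indivisible_bigcup (U : Type) (G : set (U -> U)) (X : set U)
    (R : nat -> set U) n :
  permutation_group G -> age_indivisible G X -> X !=set0 ->
  age G X `<=` age G (\bigcup_(m < n) R m) ->
  exists2 m, m < n & age G X `<=` age G (R m).
Proof.
move=> GG indX [x Xx]; elim: n => [|n IHn] sX.
  (* An empty union has no room for a copy of a singleton. *)
  have [|_ [g _ gx]] := sX [set x].
    split; first exact: finite_set1.
    by exists id; [case: GG|rewrite image_id => _ ->].
  by have [] : (\bigcup_(m < 0) R m) (g x) by apply: gx; exists x.
have sX' : age G X `<=` age G (\bigcup_(m < n) R m `|` R n).
  by rewrite !bigcup_mkord big_ord_recr in sX *.
have [sP|?] := age_indivisible_setU _ _ _ _ _ GG indX sX'.
- by have [m mn ?] := IHn sP; exists m => //; apply: ltnW.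
- by exists n.
Qed.

Lemma age_embedding (U : Type) (G : set (U -> U)) (f : U -> U) (X : set U) :
  permutation_group G -> embedding G f -> age G X `<=` age G (f @` X).
Proof.
move=> [_ _ Gcomp _] [_ femb] A [finA [g Gg gA]]; split=> //.
have [h Gh hf] := femb _ (finite_image g finA).
exists (h \o g); first exact: Gcomp.
move=> _ [a Aa <-] /=; have gaA : (g @` A) (g a) by exists a.
by rewrite hf//; exists (g a) => //; apply: gA.
Qed.

(* The translates of a typeset are indexed by codes of the images of its base;
   [R n] is empty when [n] is not such a code. *)
Lemma typeset_translates (U : Type) (G : set (U -> U)) (T : gtype U) :
  [set: U] #= [set: nat] -> permutation_group G ->
  exists R : nat -> set U, (forall n, age G (R n) `<=` rank G T) /\
    forall f, embedding G f -> exists n, f @` typeset G T `<=` R n.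
Proof.
move=> /card_set_bijP[c]; rewrite setTT_bijective => -[d cK dK] GG.
have [Gbij G1 Gcomp Ginv] := GG.
have [s sE] : exists s : seq nat, c @` gbase T = [set` s].
  by apply/finite_seqP/finite_image/gbase_finite.
pose code (f : U -> U) := pickle [seq c (f (d i)) | i <- s].
have baseE x : gbase T x <-> c x \in s.
  have -> : c x \in s = [set` s] (c x) :> Prop by [].
  by rewrite -sE; split=> [?|[y Ty /(can_inj cK)<-//]]; exists x.
have codeP f g : code f = code g -> forall x, gbase T x -> f x = g x.
  move=> /(pcan_inj (@pickleK _))/eq_in_map fg x /baseE/fg.
  by rewrite cK => /(can_inj cK).
exists (fun n =>
  [set y | exists g, [/\ G g, code g = n & (g @` typeset G T) y]]).
split=> [n A [finA [h Gh hA]]|f [_ femb]].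
  split=> //; have [[g [Gg gn]]|nex] := pselect (exists g, G g /\ code g = n).
    (* Any [k] of code [n] in the group agrees with [g] on the base, so [g' \o k] fixes the base
       pointwise and [g'] brings [R n] back into the typeset. *)
    have [g' gK g'K] := Gbij g Gg; have Gg' := Ginv _ _ Gg gK g'K.
    exists (g' \o h); first exact: Gcomp.
    move=> _ [a Aa <-] /=.
    have [|k [Gk kn [_ [t [Gt tT] <-] <-]]] := hA (h a); first by exists a.
    exists (g' \o (k \o t)) => //; split=> [|y Ty /=].
      exact: Gcomp Gg' (Gcomp _ _ Gk Gt).
    by rewrite tT// (codeP k g)// kn.
  (* Here [R n] is empty, hence so is [A]. *)
  exists id => // _ [a Aa <-].
  have [|k [Gk kn _]] := hA (h a); first by exists a.
  by case: nex; exists k.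
(* [f] may lie outside [G], but for each [y] a group element agreeing with it on the base and at [y]
   has the same code. *)
exists (code f) => _ [y Ty <-].
have [|g Gg gf] := femb (gbase T `|` [set y]).
  by rewrite finite_setU; split; [apply: gbase_finite|apply: finite_set1].
exists g; split=> //; last by exists y => //; apply: gf; right.
congr pickle; apply/eq_in_map => i si; congr c; apply: gf; left.
by apply/baseE; rewrite dK.
Qed.

Lemma rank_sub (U : Type) (G : set (U -> U)) (T S : gtype U) (f : U -> U)
    (R : nat -> set U) n :
  permutation_group G -> age_indivisible_type G T -> embedding G f ->
  (forall m, age G (R m) `<=` rank G S) ->
  f @` typeset G T `<=` \bigcup_(m < n) R m -> rank G T `<=` rank G S.
Proof.
move=> GG indT femb RS fR.
have T0 : typeset G T !=set0.
  by exists (gpoint T); exists id => //; split=> //; case: GG.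
have [|m _ TR] := @age_indivisible_bigcup U G _ R n GG indT T0.
  by apply: subset_trans (ageS _ _ _ _ fR); apply: age_embedding.
exact: subset_trans TR (RS m).
Qed.

Theorem theorem2p2 (U : Type) (G : set (U -> U)) (T S : gtype U) :
  [set: U] #= [set: nat] ->
  permutation_group G ->
  age_indivisible_type G T ->
  age_indivisible_type G S ->
  infinite_set (typeset G T) ->
  infinite_set (typeset G S) ->
  (rank G T `\` rank G S) !=set0 ->
  (rank G S `\` rank G T) !=set0 ->
  divisible G.
Proof.
move=> cU GG indT indS _ _ [A [TA nSA]] [B [SB nTB]] indG.
have [RT [RTT RTf]] := typeset_translates _ _ T cU GG.
have [RS [RSS RSf]] := typeset_translates _ _ S cU GG.
pose S1 := [set x | exists n, RT n x /\ forall m, m < n -> ~ RS m x].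
have [|i [f femb]] := indG (~` S1) S1.
  by split; [rewrite setUC setUv|rewrite setICl].
case: i => fS.
- apply: nTB; have [m fm] := RSf f femb.
  (* Ties go to [S1], hence the bound [m.+1] here against [n] in the other case. *)
  apply: (@rank_sub U G S T f RT m.+1) SB => // y fy.
  have [n [Tn nS]] : S1 y by apply: fS; case: fy => x _ <-; exists x.
  exists n => //=; rewrite ltnS leqNgt; apply/negP => /nS; apply.
  exact: fm.
- apply: nSA; have [n fn] := RTf f femb.
  apply: (@rank_sub U G T S f RS n) TA => // y fy.
  have nS1 : ~ S1 y by apply: fS; case: fy => x _ <-; exists x.
  apply: contrapT => nR; apply: nS1; exists n; split; first exact: fn.
  by move=> m mn Rm; apply: nR; exists m.
Qed.
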